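(* Let $(W,S)$ be a Coxeter system with $S$ finite. The set of tight gates $$\Gamma^0=\{g\in\Gamma\mid|\Phi^R(g)|=1\}$$ is closed under (non-identity) suffixes: if $g\in\Gamma^0$ and $g=uv$ with $u,v\in W$, $\ell(g)=\ell(u)+\ell(v)$ and $v\neq e$, then $v\in\Gamma^0$.
   Context: $(W,S)$ is a Coxeter system with $S$ finite and $\ell$ is the word length with respect to $S$. $V$ is the real vector space with basis $\{\alpha_s\mid s\in S\}$ and symmetric bilinear form $\langle\alpha_s,\alpha_t\rangle=-\cos(\pi/m(s,t))$ (equal to $-1$ if $m(s,t)=\infty$); $W$ acts on $V$ by $sv=v-2\langle v,\alpha_s\rangle\alpha_s$. Right weak order: $x\preceq y$ iff $\ell(y)=\ell(x)+\ell(x^{-1}y)$. Right descent set: $D_R(w)=\{s\in S\mid\ell(ws)=\ell(w)-1\}$; right-descent roots: $\Phi^R(w)=\{-w\alpha_s\mid s\in D_R(w)\}$. Cone type of $w$: $T(w)=\{v\in W\mid\ell(wv)=\ell(w)+\ell(v)\}$; $\mathbb{T}=\{T(w)\mid w\in W\}$. For $T\in\mathbb{T}$ the cone type part is $Q(T)=\{x\in W\mid T(x^{-1})=T\}$. It is known that each $Q(T)$ has a unique element $g_T\in Q(T)$ with $g_T\preceq x$ for all $x\in Q(T)$, called the gate of $Q(T)$; $\Gamma=\{g_T\mid T\in\mathbb{T}\}$ is the set of gates. *)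

(* Defs.v *)
From HB Require Import structures.
From mathcomp Require Import all_boot all_order all_algebra.
From mathcomp Require Import all_classical all_reals all_analysis.
From mathcomp Require Import ring.

Set Implicit Arguments.
Unset Strict Implicit.
Unset Printing Implicit Defensive.

Import Order.TTheory GRing.Theory Num.Theory.

Local Open Scope classical_set_scope.
Local Open Scope card_scope.
Local Open Scope group_scope.

(* A Coxeter system (W, S), S being embedded in W by [gen].  The value
   [cox_m s t = 0] encodes m(s,t) = oo, so that the corresponding relation
   (st)^0 = 1 is void.  [cox_gen], [cox_rel] and [cox_univ] together say that W
   has the presentation < S | (st)^m(s,t) = 1 >; in [cox_gen] words without
   inverses suffice because the generators are involutions. *)
Record coxeterSystem (W : groupType) (S : finType) := CoxeterSystem {
  gen : S -> W;
  cox_m : S -> S -> nat;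
  gen_inj : injective gen;
  cox_m_diag : forall s, cox_m s s = 1%N;
  cox_m_sym : forall s t, cox_m s t = cox_m t s;
  cox_m_offdiag : forall s t, s != t -> cox_m s t != 1%N;
  cox_gen : forall w : W, exists ss : seq S, w = \prod_(s <- ss) gen s;
  cox_rel : forall s t, (gen s * gen t) ^+ cox_m s t = 1;
  cox_univ : forall (H : groupType) (f : S -> H),
    (forall s t, (f s * f t) ^+ cox_m s t = 1) ->
    exists2 phi : W -> H,
      {morph phi : x y / x * y} & forall s, phi (gen s) = f s
}.

Section Length.
Variables (W : groupType) (S : finType) (C : coxeterSystem W S).

Definition has_word (w : W) (n : nat) : bool :=
  [exists ss : n.-tuple S, w == \prod_(s <- ss) gen C s].

Lemma has_word_ex (w : W) : exists n, has_word w n.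
Proof.
have [ss ->] := cox_gen C w; exists (size ss).
by apply/existsP; exists (in_tuple ss).
Qed.

Definition length (w : W) : nat := ex_minn (has_word_ex w).

Definition weak_le (x y : W) : Prop :=
  length y = (length x + length (x^-1 * y))%N.

(* The equation l(ws) = l(w) - 1, written without truncated subtraction. *)
Definition right_descent (w : W) : set S :=
  [set s | (length (w * gen C s)).+1 = length w].

Definition cone_type (w : W) : set W :=
  [set v | length (w * v) = (length w + length v)%N].

Definition cone_types : set (set W) := range cone_type.

Definition cone_type_part (T : set W) : set W :=
  [set x | cone_type x^-1 = T].

Definition is_gate (T : set W) (g : W) : Prop :=
  cone_type_part T g /\ forall x, cone_type_part T x -> weak_le g x.

Definition gates : set W := [set g | exists2 T, cone_types T & is_gate T g].

End Length.

Section GeometricRepresentation.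
Variables (W : groupType) (S : finType) (C : coxeterSystem W S) (R : realType).
Local Open Scope ring_scope.

Local Notation V := {ffun S -> R^o}.

Definition simple_root (s : S) : V := [ffun t => (t == s)%:R].

Definition gram (s t : S) : R :=
  if cox_m C s t == 0%N then - 1 else - cos (pi / (cox_m C s t)%:R).

Definition bform (u v : V) : R := \sum_s \sum_t u s * v t * gram s t.

Definition reflection (s : S) (v : V) : V :=
  v - (2 * bform v (simple_root s)) *: simple_root s.

Definition is_geometric_action (a : W -> V -> V) : Prop :=
  [/\ forall v, a 1%g v = v,
      forall x y v, a (x * y)%g v = a x (a y v) &
      forall s v, a (gen C s) v = reflection s v].

Lemma bformDl u v w : bform (u + v) w = bform u w + bform v w.
Proof.
rewrite /bform -big_split; apply: eq_bigr => s _ /=.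
rewrite -big_split; apply: eq_bigr => t _ /=.
by rewrite ffunE !mulrDl.
Qed.

Lemma bformZl a u w : bform (a *: u) w = a * bform u w.
Proof.
rewrite /bform mulr_sumr; apply: eq_bigr => s _.
rewrite mulr_sumr; apply: eq_bigr => t _.
by rewrite ffunE /= /GRing.scale /= !mulrA.
Qed.

Lemma bform_simple s t : bform (simple_root s) (simple_root t) = gram s t.
Proof.
rewrite /bform (bigD1 s)//= (bigD1 t)//= !ffunE !eqxx !mul1r.
rewrite !big1 ?addr0// => [i /negPf si|i /negPf ti].
  by rewrite big1// => j _; rewrite ffunE si !mul0r.
by rewrite ffunE ti mulr0 mul0r.
Qed.

Lemma gram_diag s : gram s s = 1.
Proof. by rewrite /gram cox_m_diag/= divr1 cospi opprK. Qed.

Lemma gram_sym s t : gram s t = gram t s.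
Proof. by rewrite /gram cox_m_sym. Qed.

Lemma bform_reflection s u v :
  bform (reflection s u) v =
  bform u v - 2 * bform u (simple_root s) * bform (simple_root s) v.
Proof. by rewrite /reflection -scaleNr bformDl bformZl mulNr. Qed.

Lemma reflectionK s : involutive (reflection s).
Proof.
move=> v; rewrite {1}/reflection bform_reflection bform_simple gram_diag.
rewrite /reflection -addrA -opprD -scalerDl -[RHS]subr0; congr (_ - _).
set b := bform _ _; rewrite (_ : _ + _ = 0) ?scale0r//; ring.
Qed.

(* With x = pi / m(s,t), p = <v, a_s> and q = <v, a_t>, the k-th iterate of the
   rotation s t at v is v - (2 / sin x ^ 2) (A_k a_s + B_k a_t), where
   A_k = sin (k x) (p sin (k x) + q sin ((k + 1) x)) and
   B_k = sin (k x) (q sin (k x) + p sin ((k - 1) x)). *)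
Lemma iter_reflection s t (x : R) k v : gram s t = - cos x -> sin x != 0 ->
  let p := bform v (simple_root s) in let q := bform v (simple_root t) in
  let y := k%:R * x in
  iter k (fun v => reflection s (reflection t v)) v =
  v - (2 / sin x ^+ 2 * (sin y * (p * sin y + q * sin (y + x)))) *: simple_root s
    - (2 / sin x ^+ 2 * (sin y * (q * sin y + p * sin (y - x)))) *: simple_root t.
Proof.
move=> gst sx0 p q /=; elim: k => [|k IHk].
  by rewrite /= mul0r sin0 !mul0r !mulr0 !scale0r !subr0.
rewrite iterS IHk; set y := k%:R * x.
have -> : k.+1%:R * x = y + x by rewrite -natr1 mulrDl mul1r.
rewrite [LHS]/reflection bform_reflection [in LHS]/reflection.
rewrite -!scaleNr !(bformDl, bformZl) !bform_simple.
rewrite (gram_sym t s) !gram_diag gst -/p -/q.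
have cs : cos x ^+ 2 = 1 - sin x ^+ 2 by rewrite -(cos2Dsin2 x) addrK.
rewrite addrK !sinD !cosD !sinN !cosN.
apply/ffunP => i; rewrite !ffunE /GRing.scale /=.
set a := sin y; set b := cos y.
set c := cos x in cs *; set d := sin x in sx0 cs *.
set e := (i == s)%:R; set f := (i == t)%:R.
have ab : b ^+ 2 = 1 - a ^+ 2 by rewrite -(cos2Dsin2 y) addrK.
field: ab cs.
exact: sx0.
Qed.

Lemma reflection_braid s t v :
  iter (cox_m C s t) (fun v => reflection s (reflection t v)) v = v.
Proof.
have [<-|st] := eqVneq s t.
  by rewrite cox_m_diag /= reflectionK.
case m0: (cox_m C s t) => [//|[|m]].
  by move: (cox_m_offdiag C st); rewrite m0.
have gst : gram s t = - cos (pi / m.+2%:R) by rewrite /gram m0.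
have sx0 : sin (pi / m.+2%:R : R) != 0.
  rewrite gt_eqF// sin_gt0_pi// divr_gt0 ?pi_gt0 ?ltr0n//=.
  by rewrite ltr_pdivrMr ?ltr0n// ltr_pMr ?pi_gt0// ltr1n.
rewrite (iter_reflection _ _ gst sx0) [_ * (_ / _)]mulrC divfK ?pnatr_eq0//.
by rewrite sinpi !mul0r mulr0 !scale0r !subr0.
Qed.

End GeometricRepresentation.

(* The group of bijections of a type, in which the simple reflections live. *)
Section Bijections.
Variable T : Type.

Record bijection := Bijection {
  bij_fun : T -> T;
  bij_inv : T -> T;
  bij_funK : cancel bij_fun bij_inv;
  bij_invK : cancel bij_inv bij_fun
}.

Lemma bijection_eq (f g : bijection) : bij_fun f = bij_fun g -> f = g.
Proof.
case: f g => [f f' fK f'K] [g g' gK g'K] /= fg; subst g.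
have fg' : f' = g' by apply/funext => x; rewrite -{1}(g'K x) fK.
by subst g'; congr Bijection; exact: Prop_irrelevance.
Qed.

HB.instance Definition _ := gen_eqMixin bijection.
HB.instance Definition _ := gen_choiceMixin bijection.

Definition bij_one : bijection := @Bijection id id (frefl _) (frefl _).

Definition bij_mul (f g : bijection) : bijection :=
  Bijection (can_comp (bij_funK f) (bij_funK g))
            (can_comp (bij_invK g) (bij_invK f)).

Definition bij_opp (f : bijection) : bijection :=
  Bijection (bij_invK f) (bij_funK f).

Fact bij_mulA : associative bij_mul.
Proof. by move=> f g h; exact: bijection_eq. Qed.

Fact bij_mul1 : left_id bij_one bij_mul.
Proof. by move=> f; exact: bijection_eq. Qed.

Fact bij_mulr1 : right_id bij_one bij_mul.
Proof. by move=> f; exact: bijection_eq. Qed.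

Fact bij_mulV : left_inverse bij_one bij_opp bij_mul.
Proof. by move=> f; apply/bijection_eq/funext => x /=; rewrite bij_funK. Qed.

Fact bij_mulrV : right_inverse bij_one bij_opp bij_mul.
Proof. by move=> f; apply/bijection_eq/funext => x /=; rewrite bij_invK. Qed.

HB.instance Definition _ := isGroup.Build bijection
  bij_mulA bij_mul1 bij_mulr1 bij_mulV bij_mulrV.

Lemma bij_funM (f g : bijection) x : bij_fun (f * g) x = bij_fun f (bij_fun g x).
Proof. by []. Qed.

Lemma bij_funX (f : bijection) n x : bij_fun (f ^+ n) x = iter n (bij_fun f) x.
Proof. by elim: n x => [//|n IHn] x; rewrite expgS bij_funM IHn. Qed.

End Bijections.

Section GeometricAction.
Variables (W : groupType) (S : finType) (C : coxeterSystem W S) (R : realType).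

Local Notation V := {ffun S -> R^o}.

Lemma geometric_action_ex : exists a : W -> V -> V, is_geometric_action C a.
Proof.
pose f s := Bijection (reflectionK C (R := R) s) (reflectionK C s).
have fP s t : (f s * f t) ^+ cox_m C s t = 1.
  by apply/bijection_eq/funext => v; rewrite bij_funX; exact: reflection_braid.
have [phi phiM phi_gen] := cox_univ fP.
exists (fun w => bij_fun (phi w)); split=> [v|x y v|s v].
- suff -> : phi 1 = 1 by [].
  by apply: (mulgI (phi 1)); rewrite -phiM !mulg1.
- by rewrite phiM.
- by rewrite phi_gen.
Qed.

Lemma geometric_action_unique (a b : W -> V -> V) :
  is_geometric_action C a -> is_geometric_action C b -> a = b.
Proof.
move=> [a1 aM ag] [b1 bM bg]; apply/funext => w; have [ss ->] := cox_gen C w.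
apply/funext; elim: ss => [|s ss IHss] v.
  by rewrite big_nil a1 b1.
by rewrite big_cons aM bM ag bg IHss.
Qed.

Definition act : W -> V -> V := sval (cid geometric_action_ex).

Lemma actP : is_geometric_action C act.
Proof. exact: svalP (cid geometric_action_ex). Qed.

Definition right_descent_roots (w : W) : set V :=
  [set (- act w (simple_root R s))%R | s in right_descent C w].

Definition tight_gates : set W :=
  [set g | gates C g /\ right_descent_roots g #= `I_1].

End GeometricAction.

(* Main.v *)
Require Import Defs.
From mathcomp Require Import all_boot all_order all_algebra.
From mathcomp Require Import all_classical all_reals all_analysis.
From mathcomp Require Import zify.

Local Open Scope group_scope.

(* If [g = u * v] is reduced and [x] lies in the same cone type part as [v], then
   [u * x] is reduced and lies in the same cone type part as [g], because the cone
   type of a reduced product [y * z] is determined by [z] and the cone type of [y].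
   So a gate [g] satisfies [g <= u * x] in the weak order, and cancelling [u] gives
   [v <= x]: suffixes of gates are gates.  Right descents of a suffix of [g] are
   right descents of [g], so a nontrivial suffix of a tight gate has exactly one. *)

Section CoxeterLength.
Context {W : groupType} {S : finType} (C : coxeterSystem W S).
Implicit Types u v x y z : W.

Lemma gen_sqr s : gen C s * gen C s = 1.
Proof. by rewrite -[LHS]expg1 -(cox_m_diag C s) cox_rel. Qed.

Lemma gen_inv s : (gen C s)^-1 = gen C s.
Proof. by apply: (mulgI (gen C s)); rewrite mulgV gen_sqr. Qed.

Lemma length_word (ss : seq S) : (length C (\prod_(s <- ss) gen C s) <= size ss)%N.
Proof.
rewrite /length; case: ex_minnP => n _; apply.
by apply/existsP; exists (in_tuple ss).
Qed.

Lemma reduced_word x :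
  exists2 ss : seq S, x = \prod_(s <- ss) gen C s & size ss = length C x.
Proof.
rewrite /length; case: ex_minnP => n /existsP[ss /eqP xE] _.
by exists ss; rewrite // size_tuple.
Qed.

Lemma length_gen s : (length C (gen C s) <= 1)%N.
Proof. by have := length_word [:: s]; rewrite big_seq1. Qed.

Lemma lengthM x y : (length C (x * y) <= length C x + length C y)%N.
Proof.
have [xs xE <-] := reduced_word x; have [ys yE <-] := reduced_word y.
by rewrite xE yE -big_cat -size_cat length_word.
Qed.

(** Reversing a word for [y] gives a word for its inverse, since generators are involutions;
    applying this bound to [x] and to its inverse gives equality. *)
Lemma length_invg x : length C x^-1 = length C x.
Proof.
suff le y : (length C y^-1 <= length C y)%N.
  by apply/eqP; rewrite eqn_leq le -{1}[x]invgK le.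
have [ss yE <-] := reduced_word y; rewrite {}yE.
suff -> : (\prod_(s <- ss) gen C s)^-1 = \prod_(s <- rev ss) gen C s.
  by rewrite -size_rev length_word.
elim: ss => [|s ss IHss]; first by rewrite !big_nil invg1.
by rewrite big_cons invgM IHss gen_inv rev_cons -cats1 big_cat big_seq1.
Qed.

(** By subadditivity l(yzw) <= l(y) + l(zw) <= l(y) + l(z) + l(w), so the outer terms agree iff both
    inequalities are equalities. *)
Lemma cone_type_mul y z w : cone_type C y z ->
  cone_type C (y * z) w <->
  cone_type C y (z * w) /\ length C (z * w) = (length C z + length C w)%N.
Proof.
have mulA : y * (z * w) = y * z * w := mulgA y z w.
rewrite /cone_type /= mulA => yz.
have := lengthM y (z * w); have := lengthM z w; rewrite mulA; lia.
Qed.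

Lemma gate_suffix u v : gates C (u * v) ->
  length C (u * v) = (length C u + length C v)%N -> gates C v.
Proof.
move=> [_ _ [<- uv_min]] luv.
exists (cone_type C v^-1); first by exists v^-1.
split=> // x xv; rewrite /cone_type_part /= in xv uv_min.
(* Parts are defined through inverses, so the reducedness of [u * v] is read off its inverse and
   then carried over to [x]. *)
have vu : cone_type C v^-1 u^-1.
  by rewrite /cone_type /= -invgM !length_invg luv addnC.
have xu : cone_type C x^-1 u^-1 by rewrite xv.
have lux : length C (u * x) = (length C u + length C x)%N.
  by have := xu; rewrite /cone_type /= -invgM !length_invg addnC.
have uxE : cone_type C (u * x)^-1 = cone_type C (u * v)^-1.
  by rewrite !invgM; apply/seteqP; split=> w; rewrite !cone_type_mul// xv.
have cancel_u : (u * v)^-1 * (u * x) = v^-1 * x by rewrite invgM mulgA mulgVK.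
have := uv_min _ uxE; rewrite /weak_le cancel_u lux luv; lia.
Qed.

(** Subadditivity gives l(uvs) <= l(u) + l(vs) = l(uv) - 1, and multiplying by one generator lowers
    the length by at most 1. *)
Lemma right_descent_suffix u v s :
  length C (u * v) = (length C u + length C v)%N ->
  right_descent C v s -> right_descent C (u * v) s.
Proof.
have mulA : u * v * gen C s = u * (v * gen C s) by rewrite mulgA.
have mulK : u * v = u * v * gen C s * gen C s by rewrite -mulgA gen_sqr mulg1.
rewrite /right_descent /= => luv vs.
have := lengthM u (v * gen C s); have := lengthM (u * v * gen C s) (gen C s).
have := length_gen s; rewrite -mulK mulA; lia.
Qed.

Lemma right_descent_nonempty v : v <> 1 -> exists s, right_descent C v s.
Proof.
have [ss] := reduced_word v; case/lastP: ss => [->|ss s vE lv _].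
  by rewrite big_nil.
(* The last letter of a reduced word is a right descent. *)
exists s; rewrite /right_descent /=.
have vsE : v * gen C s = \prod_(t <- ss) gen C t.
  by rewrite vE -cats1 big_cat big_seq1 /= -mulgA gen_sqr mulg1.
have mulK : v * gen C s * gen C s = v by rewrite -mulgA gen_sqr mulg1.
have := lengthM (v * gen C s) (gen C s); have := length_gen s.
have := length_word ss; rewrite -vsE mulK -lv size_rcons; lia.
Qed.

End CoxeterLength.

Theorem corollary2 (W : groupType) (S : finType) (C : coxeterSystem W S)
    (R : realType) (g u v : W) :
  tight_gates C R g -> g = u * v -> length C g = (length C u + length C v)%N ->
  v <> 1 -> tight_gates C R v.
Proof.
move=> [g_gate g_tight] gE; rewrite {}gE in g_gate g_tight *.
move=> luv v1; split; first exact: (gate_suffix C u v).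
have [a1 aM _] := actP C R; have [s vs] := right_descent_nonempty C v v1.
have uK (x : {ffun S -> R^o}) : act C u^-1 (act C u x) = x.
  by rewrite -aM mulVg a1.
(* Cardinality 1 yields a root [r] whose removal leaves the empty set. *)
have /(eq_cardSP _ 0)[r _] := g_tight; rewrite II0 card_eq0 => /eqP roots_r.
have rootE t : right_descent C v t ->
    (- act C (u * v) (simple_root R t))%R = r.
  move=> vt; apply: contrapT => tr.
  suff : set0 (- act C (u * v) (simple_root R t))%R by [].
  by rewrite -roots_r; split=> //; exists t => //; exact: right_descent_suffix.
suff -> : right_descent_roots C v = [set (- act C v (simple_root R s))%R]%classic.
  exact: card_set1.
apply/seteqP; split=> [_ [t vt <-]|_ ->]; last by exists s.
(* Both descents give the root [r] of [u * v]; acting by the inverse of [u] identifies their roots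
   for [v]. *)
have := rootE t vt; rewrite -(rootE s vs) !aM.
by move/GRing.oppr_inj/(congr1 (act C u^-1)); rewrite !uK => ->.
Qed.
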